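(* Let $G\cong \mathbb{Z}_3^r$ with $r\geq 1$. Then $\mathcal A (G)$ is a minimal set with respect to the Davenport constant ${\rm D}(G)$ if and only if $r\in [1,4]$ (that is, $1\le r\le 4$).
   Context: $\mathbb Z_m$ denotes the cyclic group of order $m$. For an abelian group $G$, $\mathcal F(G)$ is the free commutative monoid with basis $G$ (written multiplicatively); its elements are called sequences over $G$, i.e. finite unordered sequences (multisets) of elements of $G$ with repetition allowed. The length $|T|$ of a sequence is the number of its terms counted with multiplicity, $\sigma(T)$ is the sum of its terms, and $T'$ is a subsequence of $T$ if $T'$ divides $T$ in $\mathcal F(G)$ (sub-multiset). A sequence $T$ is zero-sum if $\sigma(T)=0$; it is a minimal zero-sum sequence if it is nonempty, zero-sum, and has no nonempty proper (i.e. $\neq T$) zero-sum subsequence. $\mathcal B(G)$ is the set of all zero-sum sequences over $G$, and $\mathcal A(G)$ is the set of all minimal zero-sum sequences over $G$. The Davenport constant ${\rm D}(G)$ of a finite abelian group $G$ is the least positive integer $\ell$ such that every sequence over $G$ of length $\ell$ has a nonempty zero-sum subsequence. For a subset $\Omega\subset\mathcal F(G)$, ${\mathsf d}_\Omega(G)$ is the least positive integer $\ell$ such that every sequence over $G$ of length $\ell$ has a subsequence lying in $\Omega$ (and ${\mathsf d}_\Omega(G)=\infty$ if no such $\ell$ exists). One has ${\mathsf d}_{\mathcal A(G)}(G)={\rm D}(G)$. A set $\Omega\subset\mathcal B(G)$ is called minimal with respect to ${\rm D}(G)$ if ${\mathsf d}_\Omega(G)={\rm D}(G)$ and ${\mathsf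 d}_{\Omega'}(G)\neq {\rm D}(G)$ for every proper subset $\Omega'\subsetneq\Omega$. *)

(* Defs.v *)
From mathcomp Require Import all_boot all_order all_algebra.
From mathcomp Require Import finmap multiset boolp classical_sets.

Set Implicit Arguments.
Unset Strict Implicit.
Unset Printing Implicit Defensive.

Import GRing.Theory.

Local Open Scope ring_scope.
Local Open Scope mset_scope.
Local Open Scope classical_set_scope.

Section ZeroSumSequences.
Variable G : finZmodType.

(* Sequences over G, i.e. the elements of the free commutative monoid F(G),
   are finite multisets; the length of T is [size T]. *)
Definition msum (T : {mset G}) : G := \sum_(x <- T) x.

Definition zero_sum (T : {mset G}) : Prop := msum T = 0.

Definition min_zero_sum (T : {mset G}) : Prop :=
  [/\ T != mset0, zero_sum T &
      forall T' : {mset G},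
        (T' `<=` T)%mset -> T' != mset0 -> T' != T -> ~ zero_sum T'].

Definition zero_sums : set {mset G} := [set T | zero_sum T].

Definition min_zero_sums : set {mset G} := [set T | min_zero_sum T].

Definition unavoidable (Omega : set {mset G}) (l : nat) : Prop :=
  forall T : {mset G}, size T = l ->
    exists2 T' : {mset G}, (T' `<=` T)%mset & Omega T'.

(* [None] stands for the value infinity. *)
Definition d_const (Omega : set {mset G}) : option nat :=
  if pselect (exists l, (0 < l)%N && `[< unavoidable Omega l >]) is left exl
  then Some (ex_minn exl) else None.

Definition nonempty_zero_sums : set {mset G} :=
  [set T | T != mset0 /\ zero_sum T].

Lemma davenport_exists :
  exists l, (0 < l)%N && `[< unavoidable nonempty_zero_sums l >].
Proof.
exists #|G|; apply/andP; split; first by apply/card_gt0P; exists 0.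
apply/asboolP => T sT.
pose f (k : 'I_(size T).+1) := \sum_(x <- take k T) x.
have /injectivePn [i [j nij fij]] : ~~ injectiveb f.
  apply/negP => /injectiveP /leq_card.
  by rewrite card_ord sT ltnn.
wlog ltij : i j nij fij / (i < j)%N => [hw|].
  case: (ltngtP i j) => [|ji|/val_inj eij]; first exact: hw.
    by apply: (hw j i) => //; rewrite eq_sym.
  by rewrite eij eqxx in nij.
have sj : (j <= size T)%N by rewrite -ltnS.
pose s := drop i (take j T).
have ps : perm_eq (seq_mset s) s by exact: perm_eq_seq_mset.
exists (seq_mset s).
  apply/msubsetP => a; rewrite mset_seqE -(count_mem_mset a T).
  by apply: leq_count_subseq; apply: subseq_trans (take_subseq _ j);
     exact: drop_subseq.
split.
  rewrite -size_mset_eq0 (perm_size ps) size_drop size_take_min.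
  by rewrite (minn_idPl sj) subn_eq0 -ltnNge.
rewrite /zero_sum /msum (perm_big _ ps) /=.
have : f i + \sum_(x <- s) x = f j.
  by rewrite /f /s -(take_takel T (ltnW ltij)) -big_cat cat_take_drop.
by rewrite fij => /(canRL (addKr _)); rewrite addNr.
Qed.

Definition davenport : nat := ex_minn davenport_exists.

Definition minimal_wrt_davenport (Omega : set {mset G}) : Prop :=
  [/\ Omega `<=` zero_sums, d_const Omega = Some davenport &
      forall Omega' : set {mset G},
        Omega' `<` Omega -> d_const Omega' <> Some davenport].

End ZeroSumSequences.

Arguments zero_sums : clear implicits.
Arguments min_zero_sums : clear implicits.
Arguments nonempty_zero_sums : clear implicits.
Arguments davenport : clear implicits.

(* Main.v *)
Require Import Defs.
From mathcomp Require Import all_boot all_order all_algebra.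
From mathcomp Require Import finmap multiset boolp classical_sets.
From mathcomp Require Import zify.

(** [A(G)] is minimal iff every minimal zero-sum sequence [A] is the only
    minimal zero-sum subsequence of some sequence [T] of length at least [D(G)].

    Write [A] as a basis of its span followed by [q] vectors [c_1, ..., c_q].
    The relations among the terms of [A] are parametrised by their coefficients
    [y] in [F_3^q] on the [c_l], and each term of [A] becomes a point [p] with
    coordinate sum 1 such that [y . p] is the coefficient of that term (a Gale
    transform). Minimality of [A] says that for every [y] other than the constants
    0 and 1 some point satisfies [y . p = 2], i.e. that the points block all
    hyperplanes of an affine space of dimension [q - 1]. If [2q - 1] of the points
    already do, doubling the remaining terms of [A], and adding twice the missing
    basis vectors of [G], gives a [T] of length at least [2r + 1 = D(G)]. In rank
    at most 4 such a subset always exists (a finite search, or all the points if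
    [A] is as long as possible).

    In rank [r >= 5] there is a minimal zero-sum sequence [A] of length [2r] such
    that every group element is the sum of a subsequence of length at most
    [2r - 2]. Any [T] that contains [A] and one more term [u] then contains a
    nonempty zero-sum sequence [u S] that is too short to contain [A]. *)

Set Implicit Arguments.
Unset Strict Implicit.
Unset Printing Implicit Defensive.

Import GRing.Theory.

(** * Blocking sets and the finite search *)

(** Structural recursion lets the finite searches be evaluated by conversion. *)
Fixpoint mod3 (n : nat) : nat := if n is n'.+3 then mod3 n' else n.

Lemma mod3E n : mod3 n = n %% 3.
Proof.
elim/ltn_ind: n => -[|[|[|n]]] IH //=.
by rewrite IH ?ltnS ?leqW // -addn3 modnDr.
Qed.

Fixpoint dot (y p : seq nat) : nat :=
  if y is a :: y' then if p is b :: p' then a * b + dot y' p' else 0 else 0.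

Fixpoint words (k n : nat) : seq (seq nat) :=
  if n is n'.+1 then [seq a :: w | a <- iota 0 k, w <- words k n'] else [:: [::]].

Lemma words_mem k n w :
  (w \in words k n) = (size w == n) && all (fun a => a < k) w.
Proof.
elim: n w => [|n IH] [|a w] //=.
  by apply/allpairsPdep => -[x [y [_ _]]].
rewrite eqSS andbCA -IH; apply/allpairsPdep/andP => [[x [y [hx hy [-> ->]]]]|[ha hw]].
  by move: hx; rewrite mem_iota.
by exists a, w; rewrite mem_iota.
Qed.

Fixpoint subs (T : Type) (k : nat) (s : seq T) : seq (seq T) :=
  match k, s with
  | 0, _ => [:: [::]]
  | _, [::] => [::]
  | k'.+1, x :: s' => [seq x :: t | t <- subs k' s'] ++ subs k s'
  end.

Lemma subs_mem (T : eqType) k (s t : seq T) :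
  t \in subs k s -> subseq t s /\ size t = k.
Proof.
elim: s k t => [|x s IH] [|k] t //=.
- by rewrite inE => /eqP->.
- by rewrite inE => /eqP->.
rewrite mem_cat => /orP[/mapP[u /IH[us <-] ->]|/IH[ts sz]].
  by rewrite eqxx.
by split=> //; apply: subseq_trans ts (subseq_cons _ _).
Qed.

(** The constant 0 stands for the empty subsequence, the constant 1 for [A] itself. *)
Definition const01 (q : nat) (y : seq nat) : bool :=
  (y == nseq q 0) || (y == nseq q 1).

(** A relation with coefficient 2 at a term cannot be realised when that term is available only
    once. *)
Definition hits (y p : seq nat) : bool := mod3 (dot y p) == 2.

Definition targets (q : nat) : seq (seq nat) :=
  [seq y <- words 3 q | ~~ const01 q y].

Definition blocking (ys P : seq (seq nat)) : bool :=
  all (fun y => has (hits y) P) ys.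

Definition points (q : nat) : seq (seq nat) :=
  [seq p <- words 3 q | mod3 (sumn p) == 1].

(** The unit vectors are the points of the terms [cs], so every candidate configuration contains
    them. *)
Definition frame (q : nat) : seq (seq nat) :=
  [seq [seq nat_of_bool (l == k) | l <- iota 0 q] | k <- iota 0 q].

(* Extends [cur] by at most [n] of the points [pts] so that all of [ys], the
   elements of [Y] missed by [cur], get hit, and tests that every extension
   contains [k] points blocking [Y]. The branches are the points hitting the first
   missed [y]; a point tried in one branch is excluded from the later ones. *)
Fixpoint search (Y : seq (seq nat)) (k n : nat) (pts cur ys : seq (seq nat)) :
    bool :=
  match ys, n with
  | [::], _ => has (blocking Y) (subs k cur)
  | _, 0 => true
  | y :: _, n'.+1 =>
      (fix branch (cs pts : seq (seq nat)) : bool :=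
         if cs is p :: cs' then
           search Y k n' pts (p :: cur) [seq z <- ys | ~~ hits z p]
           && branch cs' [seq z <- pts | z != p]
         else true) [seq p <- pts | hits y p] pts
  end.

Definition missed (Y P : seq (seq nat)) : seq (seq nat) :=
  [seq y <- Y | ~~ has (hits y) P].

(** Some point of the unknown multiset [rest] hits the first missed [y], so it is among the
    candidates. The branch to follow is that of the first candidate lying in [rest]; the candidates
    discarded before it are not in [rest], which therefore stays inside [pts]. *)
Lemma search_sound Y k n pts cur ys rest :
  search Y k n pts cur ys -> {subset rest <= pts} -> size rest <= n ->
  blocking ys rest ->
  exists P, [/\ size P = k, blocking Y P &
    forall v, count_mem v P <= count_mem v (cur ++ rest)].
Proof.
elim: n pts cur ys rest => [|n IH] pts cur [|y ys] rest.
- move=> /hasP[P /subs_mem[sP szP] bP] _ _ _; exists P; split=> //.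
  by move=> v; rewrite count_cat (leq_trans (leq_count_subseq _ sP)) ?leq_addr.
- by move=> _ _; rewrite leqn0 => /nilP->.
- move=> /hasP[P /subs_mem[sP szP] bP] _ _ _; exists P; split=> //.
  by move=> v; rewrite count_cat (leq_trans (leq_count_subseq _ sP)) ?leq_addr.
move=> + restP sz /allP hit.
have /hasP[p p_rest hp] := hit y (mem_head _ _).
have: p \in [seq p <- pts | hits y p] by rewrite mem_filter hp restP.
rewrite /=; move: [seq p <- pts | hits y p] => cs.
elim: cs pts restP => //= c cs IHcs pts restP.
rewrite inE => pcs /andP[searchc branch_cs].
have [c_rest|c_rest] := boolP (c \in rest); last first.
  apply: (IHcs _ _ _ branch_cs).
    move=> z z_rest; rewrite mem_filter restP // andbT.
    by apply: contraNneq c_rest => <-.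
  by case/orP: pcs => // /eqP pc; rewrite -pc p_rest in c_rest.
have pp := perm_to_rem c_rest.
have {searchc} := IH pts (c :: cur) _ (rem c rest) searchc.
case=> [z /mem_rem/restP // | | | P [szP bP cP]].
- by rewrite size_rem // -subn1 leq_subLR add1n.
- apply/allP => z; rewrite -[if _ then _ else _]/[seq z <- y :: ys | ~~ hits z c].
  rewrite mem_filter => /andP[nz /hit hitz].
  by move: hitz; rewrite (perm_has _ pp) /= (negbTE nz).
exists P; split=> // v; apply: leq_trans (cP v) _.
by rewrite cat_cons -cat1s !count_cat addnCA leq_add2l
           (permP pp) /= addn0.
Qed.

(** The budget 4 bounds the number of points outside the frame, one for each vector of [bs]. The
    size 2q - 1 is the largest one allowed, because 2(r + q) - (2q - 1) = 2r + 1. *)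
Lemma search_small q : 0 < q <= 4 ->
  search (targets q) q.*2.-1 4 (points q) (frame q) (missed (targets q) (frame q)).
Proof. by case: q => [|[|[|[|[|q]]]]] // _; exact: (erefl true). Qed.

Local Open Scope ring_scope.

(** * Zero-sum subsequences from differences of polynomials *)

Section Differences.
Variables (V : zmodType) (R : comNzRingType).
Implicit Types (F : V -> R) (g h v : V) (n : nat).

Definition diff g F v : R := F v - F (v + g).

(** A coordinate-free notion of degree below [n]: all [n]-fold differences vanish. *)
Fixpoint deg_lt n F : Prop :=
  if n is n'.+1 then forall g, deg_lt n' (diff g F) else forall v, F v = 0.

Lemma deg_lt_ext n F F' : F =1 F' -> deg_lt n F -> deg_lt n F'.
Proof.
elim: n F F' => [|n IH] F F' eF /= degF => [v|g]; first by rewrite -eF.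
by apply: IH (degF g) => v; rewrite /diff !eF.
Qed.

Lemma deg_lt_lin n a F b F' :
  deg_lt n F -> deg_lt n F' -> deg_lt n (fun v => a * F v + b * F' v).
Proof.
elim: n F F' => [|n IH] F F' /= degF degF' => [v|g].
  by rewrite degF degF' !mulr0 addr0.
apply: deg_lt_ext (IH _ _ (degF g) (degF' g)) => v.
by rewrite /diff !mulrBr opprD addrACA.
Qed.

Lemma deg_lt_shift n F h : deg_lt n F -> deg_lt n (fun v => F (v + h)).
Proof.
elim: n F => [|n IH] F /= degF => [v|g]; first exact: degF.
by apply: deg_lt_ext (IH _ (degF g)) => v; rewrite /diff addrAC.
Qed.

Lemma deg_ltS n F : deg_lt n F -> deg_lt n.+1 F.
Proof.
elim: n F => [|n IH] F degF g; last exact: IH.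
by move=> v; rewrite /diff !degF subr0.
Qed.

(** By the product rule, the difference of (c + l) F along g is (c + l) times the difference of F,
    minus l(g) times a shift of F. *)
Lemma deg_lt_mul n F (l : V -> R) c :
  {morph l : v w / v + w} -> deg_lt n F -> deg_lt n.+1 (fun v => (c + l v) * F v).
Proof.
move=> lD; elim: n F => [|n IH] F degF g.
  by move=> v; rewrite /diff !degF !mulr0 subr0.
have := deg_lt_lin 1 (- l g) (IH _ (degF g)) (deg_lt_shift g degF).
apply: deg_lt_ext => v.
by rewrite /diff mul1r mulNr mulrBr lD addrA [(_ + l g) * _]mulrDl opprD addrA.
Qed.

(** Each factor splits as (1 - l)(1 + l), two affine functions that raise the degree by one each. *)
Lemma deg_lt_prod (I : Type) (l : I -> {additive V -> R}) (s : seq I) :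
  deg_lt (size s).*2.+1 (fun v => \prod_(i <- s) (1 - l i v ^+ 2)).
Proof.
elim: s => [|i s IH] => [g v|]; first by rewrite /diff !big_nil subrr.
have := deg_lt_mul 1 _ (deg_lt_mul 1 (raddfD (l i)) IH).
move=> /(_ (fun v => - l i v)) deg; apply: deg_lt_ext (deg _) => [v|v w].
  by rewrite big_cons mulrA /= -subr_sqr expr1n.
by rewrite raddfD opprD.
Qed.

(** Expanded, this is the alternating sum of the values of [F] at [v] plus the sum of S, over all
    subsequences S of [gs]. *)
Definition diffs (gs : seq V) F : V -> R := foldr diff F gs.

Lemma diffs_deg_lt gs n F : deg_lt (size gs + n) F -> deg_lt n (diffs gs F).
Proof.
elim: gs n => // g gs IH n; rewrite [size _]/= addSnnS => /IH degF.
exact: degF g.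
Qed.

Lemma diffs_eq0 gs F v :
  (forall S, subseq S gs -> F (v + \sum_(x <- S) x) = 0) -> diffs gs F v = 0.
Proof.
elim: gs v => [|g gs IH] v F0 /=; first by have := F0 [::] isT; rewrite big_nil addr0.
rewrite /diff !IH ?subr0 // => S sS.
  by have := F0 (g :: S); rewrite big_cons addrA; apply; rewrite /= eqxx.
by apply: F0; apply: subseq_trans sS (subseq_cons _ _).
Qed.

Lemma diffs_id gs F v :
  (forall S, subseq S gs -> S != [::] -> F (v + \sum_(x <- S) x) = 0) ->
  diffs gs F v = F v.
Proof.
elim: gs v => [|g gs IH] v F0 //=.
rewrite /diff IH => [|S sS]; last first.
  by apply: F0; apply: subseq_trans sS (subseq_cons _ _).
rewrite diffs_eq0 ?subr0 // => S sS.
by have := F0 (g :: S); rewrite big_cons addrA; apply; rewrite /= ?eqxx.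
Qed.

End Differences.

Lemma F3_sqr (x : 'F_3) : x != 0 -> x ^+ 2 = 1.
Proof. by case: x => [[|[|[|]]] ? //=] _; apply: val_inj. Qed.

(* The indicator function of the common kernel of the [l i] is a polynomial of
   degree at most [2 * #|I|], so it is killed by more differences. *)
Lemma zero_sum_subseq (V : zmodType) (I : finType) (l : I -> {additive V -> 'F_3})
    (gs : seq V) :
  (#|I|.*2 < size gs)%N ->
  exists S, [/\ subseq S gs, S != [::] & forall i, l i (\sum_(x <- S) x) = 0].
Proof.
move=> sz; pose F v : 'F_3 := \prod_(i <- enum I) (1 - l i v ^+ 2).
have F0 : F 0 = 1.
  by rewrite /F big1_seq // => i _; rewrite raddf0 expr0n subr0.
have degF : deg_lt (size gs + 0) F.
  rewrite addn0 -(subnK sz); elim: (_ - _)%N => [|n IH]; last exact: deg_ltS.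
  by rewrite cardE; exact: deg_lt_prod.
have := diffs_deg_lt degF 0.
have [[S /and3P[sS nS lS]]|noS] := pselect (exists S, [&& subseq S gs, S != [::] &
    F (\sum_(x <- S) x) != 0]).
  move=> _; exists S; split=> // i; apply: contraNeq lS => lS.
  by rewrite /F (big_rem i) ?mem_enum //= F3_sqr // subrr mul0r.
(* If no nonempty subsequence has its sum in the common kernel, only the empty one contributes, and
   the differences at 0 equal [F 0 = 1] instead of 0. *)
rewrite diffs_id ?F0 => [/eqP|S sS nS]; first by rewrite oner_eq0.
rewrite add0r; apply: contrapT => /eqP FS; apply: noS; exists S.
by rewrite sS nS.
Qed.

(** * Relations in coordinates *)

Definition sub_count (T : eqType) (s t : seq T) : Prop :=
  forall v, (count_mem v s <= count_mem v t)%N.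

Lemma sub_count_perm (T : eqType) (s t t' : seq T) :
  perm_eq t t' -> sub_count s t -> sub_count s t'.
Proof. by move=> /permP tt' st v; rewrite -tt'. Qed.

Lemma subseq_nseq_cat (T : eqType) n (c : T) (s u : seq T) :
  subseq s (nseq n c ++ u) ->
  exists k s', [/\ (k <= n)%N, s = nseq k c ++ s' & subseq s' u].
Proof.
elim: n s => [|n IH] s; first by exists 0%N, s.
case: s => [|b s] /=; first by exists 0%N, [::]; split=> //; exact: sub0seq.
case: eqP => [->|_] /IH[k [s' [kn -> s'u]]]; first by exists k.+1, s'.
by exists k, s'; rewrite leqW.
Qed.

Section Expand.
Variables (T : eqType) (I : finType) (a : I -> T).
Implicit Types x t : I -> nat.

Definition expand x : seq T := flatten [seq nseq (x i) (a i) | i <- index_enum I].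

Lemma count_expand x v : count_mem v (expand x) = (\sum_i (a i == v) * x i)%N.
Proof.
rewrite /expand count_flatten sumnE !big_map.
by apply: eq_bigr => i _; rewrite count_nseq.
Qed.

Lemma size_expand x : size (expand x) = (\sum_i x i)%N.
Proof.
rewrite /expand size_flatten /shape sumnE !big_map.
by apply: eq_bigr => i _; rewrite size_nseq.
Qed.

Lemma expand_sub x t : (forall i, x i <= t i)%N -> sub_count (expand x) (expand t).
Proof.
by move=> xt v; rewrite !count_expand; apply: leq_sum => i _; rewrite leq_mul2l xt orbT.
Qed.

(** A subsequence of the concatenated blocks takes some number of copies from each block, and these
    numbers form [x]. They need not be unique, since [a] may repeat values. *)
Lemma sub_expand t (s : seq T) :
  sub_count s (expand t) ->
  exists2 x, (forall i, x i <= t i)%N & perm_eq s (expand x).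
Proof.
move=> /count_subseqP[u us su]; rewrite /expand in us *.
suff [x xt ux] : exists2 x, (forall i, x i <= t i)%N &
    u = flatten [seq nseq (x i) (a i) | i <- index_enum I] by exists x; rewrite // -ux.
move: us; have := index_enum_uniq I; elim: (index_enum I) u {su} => [|i e IH] u /=.
  by move=> _ /eqP->; exists (fun=> 0%N).
move=> /andP[ie ue] /subseq_nseq_cat[k [u' [kt -> /(IH _ ue)[x xt ->]]]].
exists (fun j => if j == i then k else x j) => [j|]; first by case: eqP => [->|].
rewrite eqxx; congr (_ ++ flatten _); apply/eq_in_map => j je.
by case: eqP je => // ->; rewrite (negbTE ie).
Qed.

End Expand.

Lemma sum_expand (V : zmodType) (I : finType) (a : I -> V) x :
  \sum_(v <- expand a x) v = \sum_i a i *+ x i.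
Proof.
rewrite /expand big_flatten big_map.
by apply: eq_bigr => i _; rewrite big_nseq iter_addr_0.
Qed.

Definition min_zs (V : zmodType) (A : seq V) : Prop :=
  [/\ A != [::], \sum_(v <- A) v = 0 &
    forall S, sub_count S A -> \sum_(v <- S) v = 0 -> S = [::] \/ perm_eq S A].

Lemma free_split (K : fieldType) (V : vectType K) (A : seq V) :
  exists bs cs, [/\ perm_eq A (bs ++ cs), free bs & all (mem <<bs>>%VS) cs].
Proof.
elim: A => [|x A [bs [cs [pA fb cb]]]]; first by exists [::], [::]; rewrite nil_free.
have [xb|xb] := boolP (x \in <<bs>>%VS).
  exists bs, (x :: cs); rewrite fb /= xb cb; split=> //.
  by rewrite perm_sym -[x :: cs]cat1s perm_catCA perm_cons perm_sym.
exists (x :: bs), cs; rewrite free_cons xb fb /= perm_cons; split=> //.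
apply/allP => c /(allP cb); apply: subvP.
by rewrite span_cons addvSr.
Qed.

Lemma F3_natE m n : (m%:R == n%:R :> 'F_3) = (mod3 m == mod3 n).
Proof. by rewrite !mod3E -val_eqE /= !val_Fp_nat. Qed.

Lemma mod3_small m : (m < 3)%N -> mod3 m = m.
Proof. by move=> m3; rewrite mod3E modn_small. Qed.

Definition F3_val (c : 'F_3) : nat := c.

Arguments F3_val : simpl never.

Lemma F3_val_lt c : (F3_val c < 3)%N.
Proof. exact: ltn_ord. Qed.

Lemma F3_valK c : (F3_val c)%:R = c.
Proof. exact: natr_Zp. Qed.

Lemma dot_map (T : Type) (f g : T -> nat) s :
  dot [seq f k | k <- s] [seq g k | k <- s] = (\sum_(k <- s) f k * g k)%N.
Proof. by elim: s => [|k s IH]; rewrite ?big_nil ?big_cons //= IH. Qed.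

Section Coordinates.
Variables (V : vectType 'F_3) (X cs : seq V).
Local Notation n := (size X).
Local Notation q := (size cs).
Local Notation I := ('I_n + 'I_q)%type.

Definition coordinate (i : 'I_n) (v : V) : 'F_3 := coord (in_tuple X) i v.

Definition family (i : I) : V :=
  match i with inl i => X`_i | inr l => cs`_l end.

Definition heights (x : I -> nat) : seq nat :=
  [seq x (inr l) | l : 'I_q <- enum 'I_q].

(* The relations between the vectors of [family] are parametrised by their
   coefficients [y] on [cs]: the coefficient at [i] is then [dot y (point i)]. *)
Definition point (i : I) : seq nat :=
  match i with
  | inl i => [seq F3_val (- coordinate i cs`_l) | l : 'I_q <- enum 'I_q]
  | inr l => [seq nat_of_bool (l == k) | k : 'I_q <- enum 'I_q]
  end.

Lemma dot_point_inr x l : dot (heights x) (point (inr l)) = x (inr l).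
Proof.
rewrite dot_map big_enum /= (bigD1 l) //= eqxx muln1 big1 ?addn0 // => k kl.
by rewrite eq_sym (negbTE kl) muln0.
Qed.

Hypotheses (freeX : free X) (spanX : <<X>>%VS = fullv).

(** The minus sign in [point] turns the contribution of [cs] into a subtracted dot product. *)
Lemma coordinate_sum x j :
  coordinate j (\sum_i family i *+ x i) =
    (x (inl j))%:R - (dot (heights x) (point (inl j)))%:R.
Proof.
rewrite big_sumType /= /coordinate linearD /= !linear_sum /=; congr (_ + _).
  rewrite (bigD1 j) //= big1 ?addr0 => [|i ij]; rewrite linearMn /= coord_free //.
    by rewrite eqxx.
  by rewrite (negbTE ij) mul0rn.
rewrite dot_map big_enum /= natr_sum -sumrN; apply: eq_bigr => l _.
by rewrite linearMn /= natrM F3_valK mulrN opprK mulr_natl.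
Qed.

Lemma coordinate_eq0 v : (forall j, coordinate j v = 0) -> v = 0.
Proof.
move=> v0; rewrite (@coord_span _ _ _ (in_tuple X) v) ?spanX ?memvf //.
by rewrite big1 // => i _; rewrite [coord _ _ _]v0 scale0r.
Qed.

Lemma family_sum_eq0 x :
  \sum_i family i *+ x i = 0 <->
  forall i, (x i)%:R = (dot (heights x) (point i))%:R :> 'F_3.
Proof.
split=> [x0 [j|l]|x0]; last 2 first.
- by rewrite dot_point_inr.
- by apply: coordinate_eq0 => j; rewrite coordinate_sum x0 subrr.
by apply/eqP; rewrite -subr_eq0 -coordinate_sum x0 /coordinate linear0.
Qed.

Lemma heights_words x : (forall i, x i < 3)%N -> heights x \in words 3 q.
Proof.
move=> x3; rewrite words_mem size_map size_enum_ord eqxx /=.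
by apply/allP => _ /mapP[l _ ->].
Qed.

Lemma point_words i : point i \in words 3 q.
Proof.
rewrite words_mem; case: i => i; rewrite size_map size_enum_ord eqxx /=.
  by apply/allP => _ /mapP[l _ ->]; exact: ltn_ord.
by apply/allP => _ /mapP[l _ ->]; case: eqP.
Qed.

Lemma heights_const x c : (forall l, x (inr l) = c) -> heights x = nseq q c.
Proof.
move=> xc; apply: (@eq_from_nth _ 0%N) => [|k]; rewrite size_map size_enum_ord ?size_nseq //.
by move=> kq; rewrite (nth_map (Ordinal kq)) ?size_enum_ord // xc nth_nseq kq.
Qed.

(** Only the values on [cs] matter; the 0 at the basis indices is arbitrary. *)
Lemma heights_nth y : size y = q ->
  y = heights (fun i => if i is inr l then nth 0%N y l else 0%N).
Proof.
move=> sy; apply: (@eq_from_nth _ 0%N) => [|k]; first by rewrite size_map size_enum_ord.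
rewrite sy => kq.
by rewrite (nth_map (Ordinal kq)) ?size_enum_ord // nth_enum_ord.
Qed.

(** Below 3 the congruence is an equality, so the multiplicities on [cs] determine all the
    others. *)
Lemma family_sum_val x i : \sum_i family i *+ x i = 0 -> (forall i, x i < 3)%N ->
  x i = mod3 (dot (heights x) (point i)).
Proof.
move=> x0 x3; rewrite -[LHS]mod3_small //; apply/eqP; rewrite -F3_natE.
by apply/eqP; apply: (family_sum_eq0 x).1 x0 i.
Qed.

End Coordinates.

(** * Lengthening a minimal zero-sum sequence *)

Section Extension.
Variables (V : vectType 'F_3) (bs es cs : seq V).
Local Notation X := (bs ++ es).
Local Notation n := (size X).
Local Notation q := (size cs).
Local Notation I := ('I_n + 'I_q)%type.
Local Notation coordinate := (@coordinate V X).
Local Notation a := (@family V X cs).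
Local Notation point := (@point V X cs).
Local Notation heights := (@heights V X cs).
Hypotheses (freeX : free X) (spanX : <<X>>%VS = fullv).
Hypothesis cs_span : all (mem <<bs>>%VS) cs.
Hypothesis minA : min_zs (bs ++ cs).

(** Multiplicities describing the sequence [bs ++ cs]; the vectors of [es] only complete the basis
    and get 0. *)
Definition occurs (i : I) : nat := if i is inl i then (i < size bs)%N else 1%N.

Lemma perm_expand_occurs : perm_eq (bs ++ cs) (expand a occurs).
Proof.
apply/allP => v _; apply/eqP => /=.
rewrite count_expand count_cat big_sumType /=; congr (_ + _)%N.
  rewrite -sum1_count big_mkcond (big_nth 0) big_mkord.
  rewrite (big_ord_widen n (fun i => nat_of_bool (nth 0 bs i == v))); last first.
    by rewrite size_cat leq_addr.
  rewrite big_mkcond; apply: eq_bigr => i _; rewrite nth_cat.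
  by case: ifP => _; [rewrite muln1 /=; case: (_ == _)|rewrite muln0].
rewrite -sum1_count big_mkcond (big_nth 0) big_mkord.
by apply: eq_bigr => i _; rewrite muln1 /=; case: (_ == _).
Qed.

Lemma sum_occurs : \sum_i a i *+ occurs i = 0.
Proof. by rewrite -sum_expand -(perm_big _ perm_expand_occurs); case: minA. Qed.

Lemma pt_out (i : 'I_n) : (size bs <= i)%N -> point (inl i) = nseq q 0%N.
Proof.
move=> bi; have lam0 (l : 'I_q) : coordinate i cs`_l = 0.
  have /(allP cs_span) : cs`_l \in cs by rewrite mem_nth.
  move=> /(@coord_span _ _ _ (in_tuple bs)) ->; rewrite /coordinate linear_sum big1 // => k _.
  have kn : (k < n)%N by rewrite size_cat ltn_addr.
  rewrite linearZ /=; apply/eqP; rewrite mulf_eq0; apply/orP; right.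
  have -> : bs`_k = X`_(Ordinal kn) by rewrite nth_cat /= ltn_ord.
  have ki : (Ordinal kn == i) = false.
    by rewrite -val_eqE /= ltn_eqF // (leq_trans (ltn_ord k) bi).
  by rewrite coord_free // ki.
apply: (@eq_from_nth _ 0%N) => [|k]; rewrite size_map size_enum_ord ?size_nseq // => kq.
by rewrite (nth_map (Ordinal kq)) ?size_enum_ord // lam0 oppr0 nth_nseq kq.
Qed.

(** The coordinate sum is the dot product with the all-one heights, which are those of the relation
    given by [bs ++ cs] itself. *)
Lemma sum_pt i : mod3 (sumn (point i)) = mod3 (occurs i).
Proof.
have -> : sumn (point i) = dot (heights occurs) (point i).
  by case: i => i; rewrite dot_map sumnE big_map; apply: eq_bigr => k _; rewrite mul1n.
apply/eqP; rewrite -F3_natE eq_sym; apply/eqP.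
exact: (family_sum_eq0 freeX spanX occurs).1 sum_occurs _.
Qed.

Let low : seq 'I_n := [seq i : 'I_n <- enum 'I_n | (i < size bs)%N].

(** The indices of [cs] come first so that the list of points begins with the frame. *)
Let pos : seq I :=
  [seq inr l | l : 'I_q <- enum 'I_q] ++ [seq inl i | i <- low].

Lemma mem_pos i : (i \in pos) = (occurs i == 1%N).
Proof.
rewrite mem_cat; case: i => i /=.
  have /negbTE-> : (inl i : I) \notin ([seq inr l | l : 'I_q <- enum 'I_q] : seq I).
    by apply/mapP => -[].
  rewrite mem_map => [|? ? []//]; rewrite mem_filter mem_enum andbT /=.
  by case: (_ < _)%N.
by rewrite mem_map ?mem_enum // => ? ? [].
Qed.

(** A [y] that no point hits yields coefficients at most 1 on the sequence and 0 on [es], hence a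
    zero-sum subsequence. By minimality it is empty or everything, so [y] is constant. *)
Lemma blocking_pos : blocking (targets q) [seq point i | i <- pos].
Proof.
apply/allP => y; rewrite mem_filter words_mem => /and3P[ny /eqP sy /allP y3].
apply: contraT => /hasPn no_hit.
pose x i := mod3 (dot y (point i)).
have x3 i : (x i < 3)%N by rewrite /x mod3E ltn_mod.
have yE : heights x = y.
  rewrite [RHS](heights_nth X sy); apply: eq_map => l.
  rewrite /x {1}(heights_nth X sy) dot_point_inr mod3_small // y3 // mem_nth // sy.
  exact: ltn_ord.
have x0 : \sum_i a i *+ x i = 0.
  apply/(family_sum_eq0 freeX spanX) => i; apply/eqP; rewrite F3_natE yE.
  by rewrite [mod3 (x i)]mod3_small.
have xle i : (x i <= occurs i)%N.
  have [/eqP ai|ai] := boolP (occurs i == 1%N).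
    have /no_hit : point i \in [seq point i | i <- pos] by rewrite map_f // mem_pos ai.
    by rewrite /hits -/(x i) ai; case: (x i) (x3 i) => [|[|[|]]].
  case: i ai => // i; rewrite /= eqb1 -leqNgt => bi.
  rewrite /x pt_out //; suff -> : dot y (nseq q 0%N) = 0%N by [].
  by elim: q y {ny sy y3 no_hit x x3 yE x0} => [|m IH] [|c y] //=; rewrite muln0 IH.
have [_ _ /(_ (expand a x))] := minA.
rewrite sum_expand x0 => /(_ _ erefl) [|xnil|/perm_size xA].
- by apply: (sub_count_perm _ (expand_sub a xle)); rewrite perm_sym perm_expand_occurs.
- move: ny; rewrite /const01 -yE [heights x](heights_const (x := x) (c := 0)) ?eqxx // => l.
  have /eqP := congr1 size xnil; rewrite size_expand sum_nat_eq0.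
  by move=> /forallP/(_ (inr l))/eqP.
move: ny; rewrite /const01 -yE [heights x](heights_const (x := x) (c := 1)) => [|l].
  by rewrite eqxx orbT.
move: xA; rewrite (perm_size perm_expand_occurs) !size_expand => xA.
(* Equal lengths and [x <= occurs] force equality at every index. *)
have [_ /esym] := leqif_sum (fun i (_ : predT i) => leqif_eq (xle i)).
by rewrite xA eqxx => /forallP /(_ (inr l)) /eqP.
Qed.

Lemma cs_gt0 : (0 < q)%N.
Proof.
rewrite lt0n; apply/negP => /eqP q0; have [nil_A _ _] := minA.
have bs0 : (0 < size bs)%N.
  move: nil_A q0; rewrite -size_eq0 size_cat lt0n => + sz; by rewrite sz addn0.
have n0 : (0 < n)%N by rewrite size_cat ltn_addr.
have := (family_sum_eq0 freeX spanX occurs).1 sum_occurs (inl (Ordinal n0)).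
have -> : heights occurs = [::] by apply: size0nil; rewrite size_map size_enum_ord q0.
by rewrite /= bs0 => /eqP; rewrite oner_eq0.
Qed.

Lemma size_low : size low = size bs.
Proof.
rewrite size_filter -(count_map val (fun i => i < size bs)%N) val_enum_ord.
rewrite size_cat iotaD count_cat (@eq_in_count _ _ predT) => [|i]; last first.
  by rewrite mem_iota => /andP[_ ->].
rewrite count_predT size_iota (@eq_in_count _ _ pred0) ?count_pred0 ?addn0 // => i.
by rewrite mem_iota => /andP[bi _]; apply/negbTE; rewrite -leqNgt.
Qed.

Lemma pos_uniq : uniq pos.
Proof.
have [injl injr] : injective (@inl 'I_n 'I_q) /\ injective (@inr 'I_n 'I_q).
  by split=> ? ? [].
rewrite cat_uniq (map_inj_uniq injr) (map_inj_uniq injl) (enum_uniq (ordinal q)).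
rewrite (filter_uniq _ (enum_uniq (ordinal n))) andbT /=.
by apply/hasPn => _ /mapP[i _ ->]; apply/mapP => -[].
Qed.

Lemma pos_points :
  [seq point i | i <- pos] = frame q ++ [seq point (inl i) | i <- low].
Proof.
rewrite map_cat /low /pos; congr (_ ++ _); last by rewrite -map_comp.
rewrite /frame -val_enum_ord.
transitivity [seq point (inr l) | l <- enum (ordinal q)]; first by rewrite -[LHS]map_comp.
rewrite -[RHS]map_comp; apply: eq_map => l /=.
by rewrite -map_comp; apply: eq_map => k /=; rewrite eq_sym.
Qed.

(** If q is one more than the size of [bs], then [pos] has exactly 2q - 1 elements; otherwise q is
    at most 4 and the finite search applies. *)
Lemma small_blocking : (q <= (size bs).+1)%N -> (size bs <= 4)%N ->
  exists K : seq I, [/\ uniq K, (size K <= q.*2.-1)%N &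
    blocking (targets q) [seq point i | i <- K]].
Proof.
rewrite leq_eqVlt ltnS => /orP[/eqP qE _|qb b4].
  exists pos; split; [exact: pos_uniq| |exact: blocking_pos].
  rewrite [size pos]size_cat (size_map inr) (size_map inl) size_low size_enum_ord qE.
  by lia.
have := search_small (q := q); rewrite cs_gt0 (leq_trans qb b4) => /(_ isT).
move=> /(search_sound (rest := [seq point (inl i) | i <- low])) sound.
case: sound => [_ /mapP[i + ->]|||P [szP bP /count_subseqP[P' + PP']]].
- by rewrite !mem_filter point_words sum_pt /= => /andP[->].
- by rewrite size_map size_low.
- apply/allP => y; rewrite mem_filter => /andP[/negbTE nhit /(allP blocking_pos)].
  by rewrite pos_points has_cat nhit.
(* Distinct indices may share a point, so the points found are lifted to indices by a mask on
   [pos]. *)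
rewrite -pos_points => /subseqP[m sm P'E].
exists (mask m pos); split.
- by rewrite mask_uniq ?pos_uniq.
- by rewrite -(size_map point) map_mask -P'E -(perm_size PP') szP.
- apply/allP => y /(allP bP); rewrite map_mask -P'E.
  by rewrite (perm_has _ PP').
Qed.

(** [T] takes the indices of [K] once and all others twice. A zero-sum subsequence has coefficient
    at most 1 on [K], so its heights are no target; the two constant heights give the empty sequence
    and [bs ++ cs]. *)
Lemma extension (K : seq I) : uniq K -> (size K <= q.*2.-1)%N ->
  blocking (targets q) [seq point i | i <- K] ->
  exists T : seq V, (n.*2 < size T)%N /\ forall S, sub_count S T ->
    \sum_(v <- S) v = 0 -> S = [::] \/ perm_eq S (bs ++ cs).
Proof.
move=> uK sK bK; pose t (i : I) := (2 - (i \in K))%N.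
exists (expand a t); split.
  have sumK : (\sum_(i : I) (i \in K) = size K)%N.
    by rewrite -(card_uniqP uK) -sum1_card [RHS]big_mkcond.
  have : (\sum_(i : I) (t i + (i \in K)) = (n + q) * 2)%N.
    rewrite -[X in (X + _)%N]card_ord -[X in (_ + X)%N]card_ord -card_sum.
    rewrite -sum_nat_const; apply: eq_bigr => i _.
    by rewrite /t subnK //; case: (i \in K).
  rewrite big_split /= -(size_expand a t) sumK; have := cs_gt0; move: sK.
  by move: (size (expand a t)) (size K) => m k; lia.
move=> S /sub_expand[x xt Sx]; rewrite (perm_big _ Sx) sum_expand => x0.
have x3 i : (x i < 3)%N by apply: leq_ltn_trans (xt i) _; rewrite ltnS leq_subr.
have xE i := family_sum_val freeX spanX i x0 x3.
have [/orP[/eqP y0|/eqP y1]|ny] := boolP (const01 q (heights x)).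
- left; suff x00 i : x i = 0%N.
    apply/eqP; rewrite -size_eq0 (perm_size Sx) size_expand big1 //.
  rewrite xE y0; elim: q (point i) => [|m IH] [|c y] //=; exact: IH.
- right; rewrite (perm_trans Sx) // perm_sym (perm_trans perm_expand_occurs) //.
  suff xa i : x i = occurs i.
    apply/allP => v _ /=; rewrite !count_expand; apply/eqP.
    by apply: eq_bigr => i _; rewrite xa.
  rewrite xE [RHS](family_sum_val freeX spanX i sum_occurs) => [|[j|l] //=].
    by rewrite y1 [in RHS](heights_const (x := occurs) (c := 1)).
  by case: (j < _)%N.
have yT : heights x \in targets q.
  by rewrite mem_filter ny heights_words.
have /hasP[_ /mapP[i iK ->]] := allP bK _ yT.
by rewrite /hits -xE => /eqP xi2; have := xt i; rewrite xi2 /t iK.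
Qed.

End Extension.

Lemma min_zs_perm (V : zmodType) (A A' : seq V) :
  perm_eq A A' -> min_zs A -> min_zs A'.
Proof.
move=> AA' [nA sA mA]; split.
- by apply: contraNneq nA => A'0; move: AA'; rewrite A'0 => /perm_nilP->.
- by rewrite -(perm_big _ AA').
move=> S SA' /mA[|->|SA]; [|by left|by right; apply: perm_trans SA AA'].
by apply: sub_count_perm SA'; rewrite perm_sym.
Qed.

(** Without one of its terms, a minimal zero-sum sequence has no nonempty zero-sum subsequence, so
    [zero_sum_subseq], applied to the coordinates along [bs], leaves at most twice the size of
    [bs]. *)
Lemma min_zs_size (V : vectType 'F_3) (bs cs : seq V) :
  free bs -> all (mem <<bs>>%VS) cs -> min_zs (bs ++ cs) ->
  (size cs <= (size bs).+1)%N.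
Proof.
move=> fb cb [nA _ mA]; case EA: (bs ++ cs) => [|v A] in nA mA; first by [].
have sA : (size bs + size cs)%N = (size A).+1 by rewrite -size_cat EA.
rewrite leqNgt; apply/negP => bc.
have [|S [SA nS S0]] := @zero_sum_subseq _ 'I_(size bs) (coord (in_tuple bs)) A.
  by rewrite card_ord -ltnS -sA -addnn -addnS ltn_add2l.
have bsA x : x \in v :: A -> x \in <<bs>>%VS.
  rewrite -EA mem_cat => /orP[/memv_span //|]; exact: (allP cb).
have Sv : subseq S (v :: A) by apply: subseq_trans SA (subseq_cons _ _).
have S_bs : \sum_(x <- S) x \in <<bs>>%VS.
  by rewrite big_seq memv_suml // => x xS; apply: bsA; rewrite (mem_subseq Sv).
have [x||S_nil|/perm_size SvA] := mA S.
- exact: leq_count_subseq.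
- rewrite (@coord_span _ _ _ (in_tuple bs) _ S_bs) big1 // => i _.
  by rewrite S0 scale0r.
- by rewrite S_nil in nS.
by have := size_subseq SA; rewrite SvA ltnn.
Qed.

Lemma min_zs_extension (V : vectType 'F_3) (A : seq V) :
  (\dim {:V} <= 4)%N -> min_zs A ->
  exists T : seq V, ((\dim {:V}).*2 < size T)%N /\
    forall S, sub_count S T -> \sum_(v <- S) v = 0 -> S = [::] \/ perm_eq S A.
Proof.
move=> dimV minA; have [bs [cs [pA fb cb]]] := free_split A.
have minA' := min_zs_perm pA minA.
pose es := vbasis (<<bs>>^C)%VS; pose X := bs ++ es.
have spanX : <<X>>%VS = fullv.
  by rewrite span_cat (span_basis (vbasisP _)) addv_complf.
have freeX : free X.
  rewrite cat_free fb (basis_free (vbasisP _)) (span_basis (vbasisP _)).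
  by apply/directv_addP; exact: capv_compl.
have sX : size X = \dim {:V} by rewrite -spanX; apply/esym/eqP.
have [|K [uK sK bK]] := small_blocking freeX spanX cb minA' (min_zs_size fb cb minA').
  by apply: leq_trans dimV; rewrite -sX size_cat leq_addr.
have [T [sT hT]] := extension freeX spanX cb minA' uK sK bK.
exists T; rewrite -sX; split=> // S ST S0.
have [->|SA] := hT S ST S0; [by left|right].
by rewrite (perm_trans SA) // perm_sym.
Qed.

(** * A sequence that cannot be extended *)

(* Found by computer: the points of a minimal zero-sum sequence of length 10 in
   rank 5, with a circulant coefficient matrix. In higher rank each further basis
   vector occurs twice, and is added to the last of the five vectors [cs]. *)
Definition rigid_point (i : nat) : seq nat :=
  if (i < 5)%N then rotr i [:: 0; 1; 1; 2; 0]%N else [:: 0; 0; 0; 0; 2]%N.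

(** Minimality, reduced to the 32 possible coefficient vectors on [cs]; the first five basis vectors
    already decide it. *)
Lemma rigid_point_min y : y \in words 2 5 ->
  all (fun i => mod3 (dot y (rigid_point i)) < 2)%N (iota 0 5) -> const01 5 y.
Proof.
move=> yw yP.
have: all (fun y => all (fun i => mod3 (dot y (rigid_point i)) < 2)%N (iota 0 5)
  ==> const01 5 y) (words 2 5) by [].
by move=> /allP /(_ _ yw); rewrite yP.
Qed.

(* With coefficients [y] on [cs], the vector with coordinates [w] requires the
   coefficient [x i] at the [i]th basis vector. *)
Definition short_rep (w y : seq nat) : bool :=
  let x i := mod3 (nth 0 w i + dot y (rigid_point i)) in
  all (fun i => x i < 2)%N (iota 0 5) && (sumn (map x (iota 0 5)) + sumn y <= 8)%N.

(** Decided by evaluating all 243 vectors [w]. The bound 8 is two below the ten terms formed by [cs]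
    and the first five basis vectors. *)
Lemma short_repP w : w \in words 3 5 -> has (short_rep w) (words 2 5).
Proof.
move=> ww; have: all (fun w => has (short_rep w) (words 2 5)) (words 3 5).
  by vm_compute.
by move=> /allP; exact.
Qed.

Section Rigid.
Variable V : vectType 'F_3.
Hypothesis dimV : (5 <= \dim {:V})%N.
Let X : seq V := vbasis {:V}.
(** The sign cancels the one in [point], so that the basis vectors get the prescribed points. *)
Let cs : seq V :=
  [seq \sum_(i < size X) - (nth 0%N (rigid_point i) l)%:R *: X`_i | l <- iota 0 5].
Let I := ('I_(size X) + 'I_(size cs))%type.
Let a := @family V X cs.
(** The all-one vector on [cs] forces these coefficients, as the points have coordinate sum 4 or
    2. *)
Let weight (i : I) : nat :=
  if i is inl i then (if i < 5 then 1 else 2)%N else 1%N.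

Let freeX : free X.
Proof. exact: basis_free (vbasisP _). Qed.

Let spanX : <<X>>%VS = fullv.
Proof. exact: span_basis (vbasisP _). Qed.

Let sizeX : (5 <= size X)%N.
Proof. by rewrite size_tuple. Qed.

Lemma rigid_point_words i : rigid_point i \in words 3 5.
Proof. by rewrite /rigid_point; case: ifP => //; case: i => [|[|[|[|[|i]]]]]. Qed.

Lemma point_inl (i : 'I_(size X)) : @point V X cs (inl i) = rigid_point i.
Proof.
have := rigid_point_words i; rewrite words_mem => /andP[/eqP sp /allP p3].
apply: (@eq_from_nth _ 0%N) => [|l]; first by rewrite size_map size_enum_ord sp.
rewrite size_map size_enum_ord => lq.
rewrite (nth_map (Ordinal lq)) ?size_enum_ord // nth_enum_ord //.
rewrite (nth_map 0%N) ?nth_iota ?size_iota //.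
rewrite /coordinate (coord_sum_free _ _ (X := in_tuple X)) // opprK.
rewrite /F3_val val_Fp_nat // modn_small // p3 // mem_nth // sp.
exact: lq.
Qed.

Lemma heights_weight : @heights V X cs weight = nseq 5 1%N.
Proof. exact: heights_const. Qed.

Lemma weight_lt i : (weight i < 3)%N.
Proof. by case: i => i //=; case: ifP. Qed.

Lemma weight_sum : \sum_i a i *+ weight i = 0.
Proof.
apply/(family_sum_eq0 freeX spanX) => i; apply/eqP.
rewrite F3_natE heights_weight; case: i => [i|l]; last first.
  by rewrite -[nseq 5 1%N]heights_weight dot_point_inr.
rewrite point_inl /= /rigid_point; case: ifP => // i5.
by case: (i : nat) i5 => [|[|[|[|[|k]]]]].
Qed.

Lemma rigid_min_zs : min_zs (expand a weight).
Proof.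
split.
- rewrite -size_eq0 size_expand sum_nat_eq0; apply/negP => /forallP.
  have q0 : (0 < size cs)%N by [].
  by move=> /(_ (inr (Ordinal q0))).
- by rewrite sum_expand weight_sum.
move=> S /sub_expand[x xw Sx]; rewrite (perm_big _ Sx) sum_expand => x0.
have x3 i : (x i < 3)%N by apply: leq_ltn_trans (xw i) (weight_lt i).
have xE i := family_sum_val freeX spanX i x0 x3.
have : const01 5 (heights x).
  apply: rigid_point_min.
    rewrite words_mem size_map size_enum_ord eqxx; apply/allP => _ /mapP[l _ ->].
    by rewrite ltnS; exact: (xw (inr l)).
  apply/allP => i; rewrite mem_iota => /andP[_ i5].
  have iX : (i < size X)%N by apply: leq_trans i5 sizeX.
  have := xw (inl (Ordinal iX)); rewrite xE point_inl /=.
  by rewrite i5 ltnS.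
case/orP=> /eqP y.
  left; apply/eqP; rewrite -size_eq0 (perm_size Sx) size_expand big1 // => i _.
  rewrite xE y; elim: {y} 5%N (@point V X cs i) => [|m IH] [|c p] //=; exact: IH.
right; rewrite (perm_trans Sx) //; suff xa i : x i = weight i.
  apply/allP => v _ /=; rewrite !count_expand; apply/eqP.
  by apply: eq_bigr => i _; rewrite xa.
rewrite xE [RHS](family_sum_val freeX spanX i weight_sum weight_lt).
by rewrite y heights_weight.
Qed.

(** [short_repP] on the first five coordinates of [v] supplies the coefficients on [cs], and those
    on the basis follow modulo 3. Basis vectors beyond the fifth occur twice and so admit any
    residue; the two spared terms come from the other ten. *)
Lemma rigid_sum v : exists S, [/\ sub_count S (expand a weight),
  (size S + 2 <= size (expand a weight))%N & \sum_(u <- S) u = v].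
Proof.
pose w := [seq F3_val (coordinate i v) | i : 'I_(size X) <- enum 'I_(size X)].
have sw : size w = size X by rewrite size_map size_enum_ord.
have : take 5 w \in words 3 5.
  rewrite words_mem size_takel ?sw // eqxx /=; apply/allP => c /mem_take.
  by move=> /mapP[i _ ->]; exact: F3_val_lt.
move=> /short_repP/hasP[y]; rewrite words_mem => /andP[/eqP sy /allP y2].
pose F i := mod3 (nth 0 w i + dot y (rigid_point i)).
pose x (i : I) := match i with inl i => F i | inr l => nth 0%N y l end.
have F_take i : (i < 5)%N -> mod3 (nth 0 (take 5 w) i + dot y (rigid_point i)) = F i.
  by move=> i5; rewrite nth_take.
rewrite /short_rep => /andP[/allP F2 sumF].
have {}F2 i : (i < 5)%N -> (F i < 2)%N.
  by move=> i5; rewrite -F_take // F2 // mem_iota.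
have {F_take}sumF : (\sum_(i < 5) F i + sumn y <= 8)%N.
  apply: leq_trans sumF; rewrite leq_add2r sumnE big_map -[iota 0 5]/(index_iota 0 5).
  by rewrite big_mkord; apply: leq_sum => i _; rewrite F_take.
have xw i : (x i <= weight i)%N.
  case: i => [i|l] /=; first by case: ifP => [/F2//|_]; rewrite -ltnS /F mod3E ltn_mod.
  by rewrite -ltnS y2 // mem_nth // sy; exact: (ltn_ord l).
exists (expand a x); split; first exact: expand_sub.
  rewrite !size_expand !big_sumType /= (bigID (fun i : 'I_(size X) => i < 5)%N) /=.
  rewrite [in leqRHS](bigID (fun i : 'I_(size X) => i < 5)%N) /=.
  rewrite -(big_ord_widen _ F sizeX).
  rewrite [Z in (_ <= Z + _ + _)%N](eq_bigr (fun=> 1%N)) => [|i ->//].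
  rewrite -(big_ord_widen _ (fun=> 1%N) sizeX) !sum1_card !card_ord.
  have -> : (\sum_(l < 5) nth 0 y l = sumn y)%N.
    by rewrite sumnE (big_nth 0%N) sy big_mkord.
  have : (\sum_(i < size X | ~~ (i < 5)) F i <=
          \sum_(i < size X | ~~ (i < 5)) (if i < 5 then 1 else 2))%N.
    by apply: leq_sum => i /negbTE i5; have := xw (inl i); rewrite /= i5.
  move: sumF.
  move: (\sum_(i < 5) F i)%N (\sum_(i < size X | _) F i)%N (sumn y).
  by move: (\sum_(i < size X | _) _)%N => s t u z; lia.
rewrite sum_expand; apply/eqP; rewrite -subr_eq0; apply/eqP.
apply: (coordinate_eq0 spanX) => j.
have -> u : coordinate j (u - v) = coordinate j u - coordinate j v by exact: linearB.
rewrite (coordinate_sum (cs := cs) freeX) point_inl.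
have -> : heights x = y by rewrite [RHS](@heights_nth V X cs y).
have -> : (x (inl j))%:R = (nth 0%N w j + dot y (rigid_point j))%:R :> 'F_3.
  by apply/eqP; rewrite F3_natE mod3_small // /x /= /F mod3E ltn_mod.
rewrite natrD addrK (nth_map j) ?size_enum_ord // nth_ord_enum F3_valK subrr //.
Qed.

Lemma rigid_size : size (expand a weight) = (\dim {:V}).*2.
Proof.
have : (\sum_(i < size X) (weight (inl i) + (i < 5)) = (size X).*2)%N.
  rewrite -muln2 -[X in (X * 2)%N]card_ord -sum_nat_const.
  by apply: eq_bigr => i _ /=; case: ifP.
have -> : (\sum_(i < size X) (weight (inl i) + (i < 5)) =
    \sum_(i < size X) weight (inl i) + 5)%N.
  rewrite big_split /=; congr (_ + _)%N.
  rewrite -[RHS]card_ord -sum1_card (big_ord_widen _ (fun=> 1%N) sizeX).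
  by rewrite [RHS]big_mkcond.
rewrite size_expand big_sumType /= => sum_weight.
rewrite [X in (_ + X)%N](_ : _ = 5%N); first by rewrite sum_weight [size X]size_tuple.
by rewrite sum1_card card_ord.
Qed.

End Rigid.

Lemma rigid_exists (V : vectType 'F_3) : (5 <= \dim {:V})%N ->
  exists A : seq V, [/\ min_zs A, size A = (\dim {:V}).*2 &
    forall v, exists S, [/\ sub_count S A, (size S + 2 <= size A)%N &
      \sum_(u <- S) u = v]].
Proof.
move=> dimV; eexists; split; [exact: (rigid_min_zs dimV)|exact: rigid_size|].
exact: rigid_sum.
Qed.

(** * Davenport constant *)

Section Transfer.
Local Open Scope mset_scope.
Variables (G : finZmodType) (V : zmodType) (f : {additive G -> V}) (g : V -> G).
Hypotheses (fK : cancel f g) (gK : cancel g f).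

Definition push (T : {mset G}) : seq V := map f T.
Definition pull (s : seq V) : {mset G} := seq_mset (map g s).

Lemma count_push T v : count_mem v (push T) = T (g v).
Proof.
rewrite count_map -count_mem_mset; apply: eq_count => x /=.
exact: can2_eq fK gK _ _.
Qed.

Lemma pullK s : perm_eq (push (pull s)) s.
Proof.
apply/allP => v _ /=; apply/eqP; rewrite count_push mset_seqE count_map.
by apply: eq_count => x /=; rewrite (can_eq gK).
Qed.

Lemma push_sub T' T : (T' `<=` T)%mset <-> sub_count (push T') (push T).
Proof.
split=> [/msubsetP sT v|sT]; first by rewrite !count_push.
by apply/msubsetP => x; have := sT (f x); rewrite !count_push fK.
Qed.

Lemma push_inj T T' : perm_eq (push T) (push T') -> T = T'.
Proof.
by move=> /permP pT; apply/msetP => x; have := pT (pred1 (f x)); rewrite !count_push fK.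
Qed.

Lemma sum_push T : \sum_(v <- push T) v = f (msum T).
Proof. by rewrite big_map /msum raddf_sum. Qed.

Lemma zero_sum_push T : zero_sum T <-> \sum_(v <- push T) v = 0.
Proof.
rewrite sum_push /zero_sum; split=> [->|f0]; first by rewrite raddf0.
by rewrite -[LHS]fK f0 -(raddf0 f) fK.
Qed.

Lemma push_nil T : push T = [::] <-> T = mset0.
Proof.
split=> [/(congr1 size)|->]; last by apply/nilP; rewrite /nilp size_map size_mset0.
by rewrite size_map => /eqP; rewrite size_mset_eq0 => /eqP.
Qed.

Lemma min_zero_sum_push A : min_zero_sum A <-> min_zs (push A).
Proof.
split=> [[nA /zero_sum_push sA mA]|[nA sA mA]]; split=> //.
- by apply/eqP => /push_nil A0; rewrite A0 eqxx in nA.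
- move=> S SA S0; have pS := pullK S.
  have [p0|pn0] := eqVneq (pull S) mset0.
    by left; apply: size0nil; rewrite -(perm_size pS) p0 size_map size_mset0.
  have [<-|pnA] := eqVneq (pull S) A; first by right; rewrite perm_sym.
  have := mA (pull S) _ pn0 pnA.
  rewrite zero_sum_push (perm_big _ pS) /= => /(_ _ S0) [].
  by apply/push_sub => v; rewrite (permP pS).
- by apply/eqP => A0; move: nA; rewrite A0; case/negP; apply/eqP/push_nil.
- exact/zero_sum_push.
move=> T' /push_sub sT' nT' nTA /zero_sum_push /mA[//|/push_nil|/push_inj] T'E.
  by rewrite T'E eqxx in nT'.
by rewrite T'E eqxx in nTA.
Qed.

End Transfer.

Lemma sub_count_size (T : eqType) (s t : seq T) : sub_count s t ->
  (size s <= size t)%N /\ ((size t <= size s)%N -> perm_eq s t).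
Proof.
move=> /count_subseqP[u ut su]; rewrite (perm_size su); split=> [|tu].
  exact: size_subseq.
rewrite (perm_trans su) //; suff -> : u = t by [].
by apply/eqP; rewrite -(size_subseq_leqif ut) eqn_leq size_subseq.
Qed.

Lemma sub_count_cons (T : eqType) (s t : seq T) : sub_count s t ->
  (size s < size t)%N -> exists x, sub_count (x :: s) t.
Proof.
move=> st; rewrite ltnNge => /negP size_ts.
apply: contrapT => nox; apply: size_ts; apply: (sub_count_size _).1 => x.
rewrite leqNgt; apply/negP => xs; apply: nox; exists x => y /=.
by case: eqP => [<-|_]; [rewrite add1n|exact: st].
Qed.

(** * Minimality as uniqueness of a minimal zero-sum subsequence *)

Section Davenport.
Local Open Scope mset_scope.
Variable G : finZmodType.
Implicit Types (T A : {mset G}) (Omega : set {mset G}).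

Lemma d_constP Omega l : d_const Omega = Some l <->
  [/\ (0 < l)%N, unavoidable Omega l &
      forall m, (0 < m)%N -> unavoidable Omega m -> (l <= m)%N].
Proof.
rewrite /d_const; case: pselect => [exl|nexl]; last first.
  by split=> // -[l0 /asboolP ul _]; case: nexl; exists l; rewrite l0.
case: ex_minnP => k /andP[k0 /asboolP uk] kmin; split=> [[<-]|[l0 ul lmin]].
  by split=> // m m0 um; apply: kmin; rewrite m0; exact/asboolP.
congr Some; apply/eqP; rewrite eqn_leq lmin // kmin //.
by rewrite l0; exact/asboolP.
Qed.

Lemma davenportP : [/\ (0 < davenport G)%N,
   unavoidable (nonempty_zero_sums G) (davenport G) &
   forall m, (0 < m)%N -> unavoidable (nonempty_zero_sums G) m -> (davenport G <= m)%N].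
Proof.
rewrite /davenport; case: ex_minnP => k /andP[k0 /asboolP uk] kmin; split=> // m m0 um.
by apply: kmin; rewrite m0; exact/asboolP.
Qed.

Lemma msubset_size T T' : (T' `<=` T)%mset -> T' != T -> (size T' < size T)%N.
Proof.
move=> /msubsetP sT; have sub : sub_count T' T by move=> v; rewrite !count_mem_mset.
have [le_size perm] := sub_count_size sub.
rewrite ltnNge; apply: contraNN => /perm /permP pT.
by apply/eqP/msetP => x; have := pT (pred1 x); rewrite !count_mem_mset.
Qed.

Lemma min_zero_sum_exists T : T != mset0 -> zero_sum T ->
  exists2 T', (T' `<=` T)%mset & min_zero_sum T'.
Proof.
elim/ltn_ind: (size T) {-2}T (erefl (size T)) => n IH {}T nT T0 zT.
have [mT|nmT] := pselect (min_zero_sum T); first by exists T; rewrite ?msubset_refl.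
have [T' [T'T nT' T'neq zT']] :
    exists T', [/\ (T' `<=` T)%mset, T' != mset0, T' != T & zero_sum T'].
  apply: contrapT => noT'; apply: nmT; split=> // T' T'T nT' T'neq zT'.
  by apply: noT'; exists T'.
have [|T'' T''T' mT''] := IH (size T') _ T' erefl nT' zT'.
  by rewrite -nT; exact: msubset_size.
by exists T'' => //; exact: msubset_trans T''T' T'T.
Qed.

Lemma davenport_take T : (davenport G <= size T)%N ->
  exists2 T', (T' `<=` T)%mset & size T' = davenport G.
Proof.
move=> DT; exists (seq_mset (take (davenport G) T)).
  apply/msubsetP => x; rewrite mset_seqE -(count_mem_mset x T).
  exact/leq_count_subseq/take_subseq.
by rewrite (perm_size (perm_eq_seq_mset _)) size_takel.
Qed.

Lemma davenport_min T : (davenport G <= size T)%N ->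
  exists2 A, (A `<=` T)%mset & min_zero_sum A.
Proof.
move=> /davenport_take[T' T'T sT']; have [_ /(_ T' sT')[S ST' [nS zS]] _] := davenportP.
have [A AS mA] := min_zero_sum_exists nS zS.
by exists A => //; exact: msubset_trans AS (msubset_trans ST' T'T).
Qed.

Lemma d_const_min_zero_sums : d_const (min_zero_sums G) = Some (davenport G).
Proof.
have [D0 _ Dmin] := davenportP; apply/d_constP; split=> // [T sT|m m0 um].
  by apply: davenport_min; rewrite sT.
by apply: Dmin => // T /um[A AT [nA zA _]]; exists A.
Qed.

(** If every long [T] contains a minimal zero-sum sequence other than [A], deleting [A] does not
    change the constant. Conversely, a [T] containing only [A] forces [A] into every subset with
    constant D(G). *)
Lemma minimal_davenportP : minimal_wrt_davenport (min_zero_sums G) <->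
  forall A, min_zero_sum A -> exists2 T : {mset G}, (davenport G <= size T)%N &
    forall A', (A' `<=` T)%mset -> min_zero_sum A' -> A' = A.
Proof.
have [D0 _ Dmin] := davenportP.
split=> [[_ _ minD] A mA|uniqueA].
  apply: contrapT => noT.
  apply: (minD [set B | min_zero_sum B /\ B <> A]%classic).
    split=> [B []//|/(_ A mA)[_]]; exact.
  apply/d_constP; split=> // [T sT|m m0 um]; last first.
    by apply: Dmin => // T /um[B BT [[nB zB _] _]]; exists B.
  apply: contrapT => noB; apply: noT; exists T; first by rewrite sT.
  by move=> A' A'T mA'; apply: contrapT => A'A; apply: noB; exists A'.
split=> [T []//||Omega [subO notsub]]; first exact: d_const_min_zero_sums.
move=> /d_constP[_ uD _]; apply: notsub => A mA.
have [T DT unique] := uniqueA A mA.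
have [T' T'T /uD[B BT' OB]] := davenport_take DT.
by rewrite -(unique B) //; [exact: msubset_trans BT' T'T|exact: subO].
Qed.
End Davenport.

(** * The value of D(G) and the rank criterion *)

Section Main.
Local Open Scope mset_scope.
Variables (G : finZmodType) (V : vectType 'F_3) (f : {additive G -> V}) (g : V -> G).
Hypotheses (fK : cancel f g) (gK : cancel g f).
Local Notation push := (@push G V f).
Local Notation pull := (@pull G V g).
Let pushK := @pullK G V f g fK gK.
Let push_le := @push_sub G V f g fK gK.
Let push_zero_sum := @zero_sum_push G V f g fK.
Let push_min := @min_zero_sum_push G V f g fK gK.

Lemma davenport_ub : (davenport G <= (\dim {:V}).*2.+1)%N.
Proof.
have [_ _ Dmin] := davenportP G; apply: Dmin => // T sT.
pose X := vbasis {:V}.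
have [|S [ST nS S0]] := @zero_sum_subseq _ 'I_(\dim {:V}) (coord X) (push T).
  by rewrite card_ord size_map sT.
have pS := pushK S; exists (pull S).
  apply/push_le => v; rewrite (permP pS); exact: leq_count_subseq.
split.
  apply: contraNneq nS => S_0; move: pS.
  by rewrite S_0 (@push_nil G V f _).2 // perm_sym => /perm_nilP->.
apply/push_zero_sum; rewrite (perm_big _ pS) /=.
rewrite (coord_vbasis (memvf (\sum_(v <- S) v))) big1 // => i _.
by rewrite S0 scale0r.
Qed.

(** Each basis vector taken twice gives a sequence with no nonempty zero-sum subsequence. *)
Lemma davenport_lb : ((\dim {:V}).*2 < davenport G)%N.
Proof.
rewrite ltnNge; apply/negP => Dle; pose X : seq V := vbasis {:V}.
(* With [cs] empty there are no heights, so every multiplicity in a zero sum is 0. *)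
pose a := @family V X [::]; pose two (_ : 'I_(size X) + 'I_(size (Nil V))) := 2%N.
have spanX : <<X>>%VS = fullv := span_basis (vbasisP _).
have freeX : free X := basis_free (vbasisP _).
have pT := pushK (expand a two).
have sT : size (pull (expand a two)) = (\dim {:V}).*2.
  rewrite -(size_map f) (perm_size pT) size_expand sum_nat_const card_sum !card_ord.
  by rewrite addn0 size_tuple muln2.
rewrite -sT in Dle; have [A /push_le AT mA] := davenport_min Dle.
have [nA zA _] := (push_min A).1 mA.
have [x x2 Ax] := sub_expand (sub_count_perm pT AT).
have x0 : \sum_i a i *+ x i = 0 by rewrite -sum_expand -(perm_big _ Ax).
case/eqP: nA; apply: size0nil; rewrite (perm_size Ax) size_expand big1 // => i _.
have -> := family_sum_val freeX spanX i x0 (fun i => x2 i).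
suff -> : heights x = [::] by [].
by apply: size0nil; rewrite size_map size_enum_ord.
Qed.

Lemma minimal_dim_le4 :
  minimal_wrt_davenport (min_zero_sums G) <-> (\dim {:V} <= 4)%N.
Proof.
rewrite minimal_davenportP; split=> [uniqueA|dimV A /push_min mA].
  rewrite leqNgt; apply/negP => dimV.
  have [R [minR sR sumR]] := rigid_exists dimV.
  have pA := pushK R; set A := pull R in pA.
  have mA : min_zero_sum A.
    by apply/push_min; apply: min_zs_perm minR; rewrite perm_sym.
  have [T DT uniqueT] := uniqueA A mA.
  have AT : (A `<=` T)%mset.
    by have [A' A'T mA'] := davenport_min DT; rewrite -(uniqueT A').
  have RT : sub_count R (push T) by move=> v; rewrite -(permP pA); exact: (push_le _ _).1 AT v.
  have [|u uRT] := sub_count_cons RT.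
    by rewrite size_map sR; exact: leq_trans davenport_lb DT.
  (* [u :: S] is zero-sum and lies in [T], but it is shorter than [A], the only minimal zero-sum
     sequence it could contain. *)
  have [S [SR sS sumS]] := sumR (- u).
  have pB := pushK (u :: S); set B := pull (u :: S) in pB.
  have BT : (B `<=` T)%mset.
    apply/push_le => v; apply: leq_trans (uRT v).
    by rewrite (permP pB) /= leq_add2l; exact: SR.
  have nB : B != mset0.
    by apply/eqP => /(push_nil f) B0; move: pB; rewrite B0 => /perm_size.
  have zB : zero_sum B.
    by apply/push_zero_sum; rewrite (perm_big _ pB) big_cons sumS /= subrr.
  have [A' A'B mA'] := min_zero_sum_exists nB zB.
  have A'A := uniqueT A' (msubset_trans A'B BT) mA'.
  move/push_le: A'B; rewrite A'A => /sub_count_size[+ _].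
  rewrite (perm_size pA) (perm_size pB) /= => RS.
  by have := leq_trans sS RS; rewrite addn2 ltnn.
have [T [sT uniqueT]] := min_zs_extension dimV mA.
have pT := pushK T; exists (pull T).
  by rewrite -(size_map f) (perm_size pT); exact: leq_trans davenport_ub sT.
move=> A' /push_le A'T /push_min[nA' sA' _].
have [A'0|pA'] := uniqueT _ (sub_count_perm pT A'T) sA'; first by rewrite A'0 in nA'.
exact: (push_inj fK gK pA').
Qed.
End Main.

Theorem theorem3p5 (r : nat) (hr : (1 <= r)%N) (G : finZmodType)
    (hG : exists f : {additive G -> 'rV['Z_3]_r}, bijective f) :
  minimal_wrt_davenport (min_zero_sums G) <-> (1 <= r <= 4)%N.
Proof.
have [f [g fK gK]] := hG; rewrite hr.
(* The rings ['Z_3] and ['F_3] are convertible, so [f] maps into a vector space over ['F_3]. *)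
have := @minimal_dim_le4 G ('rV['F_3]_r : vectType 'F_3) f g fK gK.
by rewrite dimvf dim_matrix mul1r.
Qed.
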